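(* Let $I$ be a set, and $\mathcal{F}$ a filter on $I$. Then the following conditions are equivalent. (a) For every partition of $I$ into infinitely many subsets $J_s$ ($s\in S$, $S$ an infinite set), there is at least one $s\in S$ such that $I-J_s\in\mathcal{F}$. (b) For every partition of $I$ into a countably infinite family of subsets $J_m$ ($m\in\omega$), there is at least one $m\in\omega$ such that $I-J_m\in\mathcal{F}$. (c) There exists $n\in\omega$ such that for every partition of $I$ into $n+1$ subsets $J_0,\dots,J_n$, there is at least one $m\in\{0,\dots,n\}$ such that $I-J_m\in\mathcal{F}$. (d) $\mathcal{F}$ is the intersection of finitely many ultrafilters on $I$. When these conditions hold, the finite set of ultrafilters having $\mathcal{F}$ as intersection is unique, and its cardinality is the least $n$ as in (c).
   Context: A filter on a set $I$ is a set $\mathcal{F}$ of subsets of $I$ such that $I\in\mathcal{F}$; if $J\in\mathcal{F}$ and $J\subseteq K\subseteq I$ then $K\in\mathcal{F}$; and if $J,K\in\mathcal{F}$ then $J\cap K\in\mathcal{F}$. A filter may be improper (i.e., equal to the set of all subsets of $I$, equivalently contain $\emptyset$). An ultrafilter is a maximal proper filter. Convention: among sets of subsets of $I$, the intersection of the empty family is the set of all subsets of $I$; thus the improper filter is the intersection of the empty (finite) family of ultrafilters. A partition of a set means an expression of it as the union of an indexed family of pairwise disjoint subsets; these subsets are not required to be nonempty (so the empty set may occur one or more times). *)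

(* Defs.v *)
From mathcomp Require Import all_boot.
From mathcomp Require Import boolp classical_sets functions cardinality filter.

Set Implicit Arguments.
Unset Strict Implicit.
Unset Printing Implicit Defensive.

Local Open Scope classical_set_scope.
Local Open Scope card_scope.

(* Unlike [partition] of [classical_sets], empty blocks are allowed, possibly
   with repetition. *)
Definition indexed_partition (I S : Type) (J : S -> set I) : Prop :=
  trivIset [set: S] J /\ \bigcup_(s in [set: S]) J s = [set: I].

Definition infinite_partition_property (I : Type) (F : set_system I) : Prop :=
  forall (S : Type) (J : S -> set I), infinite_set [set: S] ->
    indexed_partition J -> exists s, F (~` J s).

Definition omega_partition_property (I : Type) (F : set_system I) : Prop :=
  forall J : nat -> set I, indexed_partition J -> exists m, F (~` J m).

Definition finite_partition_property (I : Type) (F : set_system I) (n : nat) :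
    Prop :=
  forall J : 'I_n.+1 -> set I, indexed_partition J -> exists m, F (~` J m).

(* For U = set0 the intersection is the improper filter [set: set I]. *)
Definition finite_ultrafilter_decomposition (I : Type) (F : set_system I)
    (U : set (set_system I)) : Prop :=
  [/\ finite_set U, forall G, U G -> UltraFilter G & F = \bigcap_(G in U) G].

Definition is_least (P : nat -> Prop) (n : nat) : Prop :=
  P n /\ forall m, P m -> (n <= m)%N.

(* Main.v *)
(* For A `<=` I let F_A be the filter [within A F]: since F_(B `|` C) is the
   intersection of F_B and F_C, decomposability into finitely many ultrafilters
   passes from B and C to B `|` C. So if F is not decomposable, a set A with
   F_A not decomposable splits into two F-positive sets (F_A is neither improper
   nor an ultrafilter), one of which is again not decomposable; peeling off the
   other one forever gives an infinite disjoint family refuting (b). Conversely,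
   n ultrafilters cannot contain members of more than n disjoint blocks, while
   n distinct ultrafilters contain n pairwise disjoint members. *)
Require Import Defs.
From mathcomp Require Import all_boot.
From mathcomp Require Import boolp classical_sets functions cardinality filter.

Set Implicit Arguments.
Unset Strict Implicit.
Unset Printing Implicit Defensive.

Local Open Scope classical_set_scope.
Local Open Scope card_scope.

(** Lets the partition properties act on families that are merely disjoint: when the complement of
    [J s] lies in a filter, so does the larger complement of [A s]. All uncovered points go into
    block [s0]. *)
Lemma trivIset_enlarge {I S : Type} (s0 : S) (A : S -> set I) :
  trivIset [set: S] A ->
  exists J : S -> set I, Defs.indexed_partition J /\ forall s, A s `<=` J s.
Proof.
move=> tA; set R := ~` \bigcup_(s in [set: S]) A s.
exists (fun s => A s `|` [set x | s = s0 /\ R x]).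
split; last by move=> s; left.
split.
  move=> s t _ _ [x [[As|[-> Rx]] [At|[-> Rx']]]] //.
  - by apply: tA => //; exists x.
  - by case: Rx'; exists s.
  - by case: Rx; exists t.
rewrite -subTset => x _.
have [[s _ As]|Rx] := pselect ((\bigcup_(s in [set: S]) A s) x).
  by exists s => //; left.
by exists s0 => //; right.
Qed.

Lemma omega_of_finite {I : Type} (F : set_system I) (FF : Filter F) n :
  finite_partition_property F n -> omega_partition_property F.
Proof.
move=> Fn J [tJ _].
have [|K [pK JK]] := @trivIset_enlarge I _ ord0 (fun i : 'I_n.+1 => J i).
  by move=> i j _ _ /(tJ i j Logic.I Logic.I) /val_inj.
have [m Fm] := Fn K pK.
by exists m; apply: filterS Fm; apply: subsetC; apply: JK.
Qed.

Lemma infinite_of_omega {I : Type} (F : set_system I) (FF : Filter F) :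
  omega_partition_property F -> infinite_partition_property F.
Proof.
move=> Fw S J /infiniteP/card_leP[f] [tJ _].
(* An infinite [S] receives an injection from [nat]; the blocks it selects form a countable disjoint
   family. *)
pose g (n : nat) : S := set_val (f (to_setT n)).
have g_inj : injective g.
  move=> m n /val_inj /(@inj _ _ _ f) E.
  by have /(congr1 set_val) := E (mem_set Logic.I) (mem_set Logic.I).
have [|K [pK JK]] := @trivIset_enlarge I _ 0%N (J \o g).
  by move=> i j _ _ /(tJ _ _ Logic.I Logic.I) /g_inj.
have [m Fm] := Fw K pK.
by exists (g m); apply: filterS Fm; apply: subsetC; apply: JK.
Qed.

Lemma ultra_of_dichotomy {I : Type} (F : set_system I) :
  ProperFilter F -> (forall A, F A \/ F (~` A)) -> UltraFilter F.
Proof.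
move=> PF dich; split=> // G PG FG; rewrite eqEsubset; split=> // A GA.
case: (dich A) => // /FG GnA.
by have /filter_ex[x []] : G (A `&` ~` A) by exact: filterI.
Qed.

Definition decomposable {I : Type} (F : set_system I) : Prop :=
  exists U, finite_ultrafilter_decomposition F U.

Lemma decomposable_improper {I : Type} (F : set_system I) :
  Filter F -> F set0 -> decomposable F.
Proof.
move=> FF F0; exists set0; split=> //; rewrite bigcap_set0 -subTset => A _.
exact: filterS F0.
Qed.

Lemma decomposable_ultra {I : Type} (F : set_system I) :
  UltraFilter F -> decomposable F.
Proof.
move=> UF; exists [set F]; split=> [|G ->|] //.
by rewrite bigcap_set1.
Qed.

Lemma decomposableI {I : Type} (F G : set_system I) :
  decomposable F -> decomposable G -> decomposable (F `&` G).
Proof.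
move=> [U [Ufin Uultra ->]] [V [Vfin Vultra ->]]; exists (U `|` V); split.
- by rewrite finite_setU.
- by move=> H [/Uultra|/Vultra].
- by rewrite bigcap_setU.
Qed.

Lemma within_setU {I : Type} (F : set_system I) (A B : set I) : Filter F ->
  within (A `|` B) F = within A F `&` within B F.
Proof.
move=> FF; rewrite eqEsubset; split=> [P FP|P [FAP FBP]].
  by split; apply: (@filterS _ F _ _ _ _ FP) => x ABPx Ax; apply: ABPx;
    [left|right].
apply: (@filterS _ F _ _ _ _ (@filterI _ F _ _ _ FAP FBP)).
by move=> x [AP BP] [/AP|/BP].
Qed.

Lemma split_nondecomposable {I : Type} (F : set_system I) (A : set I) :
  Filter F -> ~ decomposable (within A F) ->
  exists B, [/\ B `<=` A, ~ decomposable (within B F) & ~ F (~` (A `\` B))].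
Proof.
move=> FF ndA.
have PA : ProperFilter (within A F).
  split; last exact: within_filter.
  by move=> W0; apply: ndA; apply: decomposable_improper.
(* [X] witnesses that [within A F] is not an ultrafilter; hence both halves of [A] cut by [X] are
   F-positive, and [B] is a nondecomposable half. *)
have [X [nX nXC]] : exists X, ~ within A F X /\ ~ within A F (~` X).
  apply: contra_notP ndA => nX.
  apply: decomposable_ultra; apply: ultra_of_dichotomy => // X.
  apply: contrapT => /not_orP nXX; by apply: nX; exists X.
have AE : A = (A `&` X) `|` (A `\` X) by rewrite -setIUr setUv setIT.
have [dX|ndX] := pselect (decomposable (within (A `&` X) F)); last first.
  exists (A `&` X); split=> // FC; apply: nX; apply: filterS FC => x nAX Ax.
  by apply: contrapT => nXx; apply: nAX; split=> // -[].
exists (A `\` X); split; first exact: subDsetl.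
  move=> dXC; apply: ndA; rewrite AE within_setU; exact: decomposableI.
move=> FC; apply: nXC; apply: filterS FC => x nAX Ax Xx.
by apply: nAX; split=> // -[].
Qed.

Lemma decomposable_of_omega {I : Type} (F : set_system I) : Filter F ->
  omega_partition_property F -> decomposable F.
Proof.
move=> FF Fw; apply: contrapT => ndF.
(* Nondecomposability is placed under the existential so that choice yields a total [f], which can
   be iterated from the whole of [I]. *)
have /choice[f fP] : forall A, exists B, ~ decomposable (within A F) ->
    [/\ B `<=` A, ~ decomposable (within B F) & ~ F (~` (A `\` B))].
  move=> A; have [dA|ndA] := pselect (decomposable (within A F)).
    by exists A.
  by have [B PB] := split_nondecomposable FF ndA; exists B.
pose C n := iter n f [set: I].
have ndC n : ~ decomposable (within (C n) F).
  by elim: n => [|n /fP[]//]; rewrite /= withinET.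
have Cdecr m n : (m <= n)%N -> C n `<=` C m.
  move=> /subnK <-; elim: (n - m)%N => [|k IH] //.
  by apply: subset_trans IH; have [] := fP _ (ndC (k + m)%N).
(* The successive differences of the decreasing sets [C n] are disjoint, and none has its complement
   in [F]. *)
have [|K [pK CK]] := @trivIset_enlarge I _ 0%N (fun n => C n `\` C n.+1).
  apply: ltn_trivIset => n m mn; rewrite -subset0 => x [[_ nCm] [Cn _]].
  by apply: nCm; apply: Cdecr Cn.
have [m FKm] := Fw K pK.
have [_ _ []] := fP _ (ndC m).
by apply: filterS FKm; apply: subsetC; apply: CK.
Qed.

Lemma card_eq_II_range {T : Type} (U : set T) n : U #= `I_n ->
  exists G : 'I_n -> T, injective G /\ U = range G.
Proof.
rewrite (card_eqr card_II) => /card_esym/card_bijP[f [h fK hK]].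
exists (fun i => set_val (f (to_setT i))); split.
  by move=> i j /val_inj /(can_inj fK) /(congr1 set_val).
rewrite eqEsubset; split=> [x Ux|_ [i _ <-]]; last exact: set_valP.
exists (set_val (h (SigSub (mem_set Ux)))) => //.
have -> y : to_setT (set_val y) = y by exact: val_inj.
by rewrite hK.
Qed.

(** Pigeonhole: were no complement of a block in [F], each of the n+1 blocks would belong to one of
    the n ultrafilters, and no ultrafilter contains two disjoint blocks. *)
Lemma finite_of_decomposition {I : Type} (F : set_system I) n
    (G : 'I_n -> set_system I) : (forall i, UltraFilter (G i)) ->
  \bigcap_i G i `<=` F -> finite_partition_property F n.
Proof.
move=> GU GF J [tJ _]; apply: contrapT => nF.
have /choice[f fP] : forall m, exists i, G i (J m).
  move=> m; apply: contrapT => nG; apply: nF; exists m; apply: GF => i _.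
  by have [GJ|//] := in_ultra_setVsetC (J m) (GU i); case: nG; exists i.
have /leq_card : injective f.
  move=> k m fkm; apply: tJ => //.
  apply: (@filter_ex _ (G (f k))); apply: filterI => //.
  by rewrite fkm.
by rewrite !card_ord ltnn.
Qed.

Lemma ultra_separation {I : Type} n (G : 'I_n -> set_system I) :
  (forall i, UltraFilter (G i)) -> injective G ->
  exists A : 'I_n -> set I, (forall i, G i (A i)) /\ trivIset [set: 'I_n] A.
Proof.
move=> GU Ginj.
have sep i j : exists B, i != j -> G i B /\ G j (~` B).
  have [->|ij] := eqVneq i j; first by exists setT.
  apply: contrapT => nB; move/eqP: ij; apply; apply: Ginj.
  symmetry; apply: max_filter => B GiB.
  have [//|GjB] := in_ultra_setVsetC B (GU j).
  by case: nB; exists B.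
have [B BP] := choice (fun p : 'I_n * 'I_n => sep p.1 p.2).
(* [B (i, j)] and [B (j, i)] are chosen independently, so both are imposed: a point common to the
   i-th and j-th sets would lie both in and outside [B (i, j)]. Finitely many [j] keep the i-th set
   in [G i]. *)
exists (fun i => [set x | forall j, i != j -> B (i, j) x /\ ~ B (j, i) x]).
split=> [i|i j _ _ [x [Ax A'x]]].
  apply: filter_forall => j.
  have [->|ij] := eqVneq i j; first exact: nearW.
  have [G1 _] := BP (i, j) ij.
  have [|_ G2] := BP (j, i); first by rewrite eq_sym.
  by apply: filterS (filterI G1 G2) => x [].
apply/eqP; apply: contrapT => /negP ij.
have [Bx _] := Ax j ij.
by have [|_] := A'x i; first by rewrite eq_sym.
Qed.

Lemma card_lower_bound {I : Type} (F : set_system I) n m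
    (G : 'I_n -> set_system I) : (forall i, UltraFilter (G i)) ->
  injective G -> (forall i, F `<=` G i) -> finite_partition_property F m ->
  (n <= m)%N.
Proof.
move=> GU Ginj FG Fm; rewrite leqNgt; apply/negP => mn.
(* If m < n, disjoint members of the first m+1 ultrafilters extend to a partition each of whose
   blocks lies in its own ultrafilter, so no complement can be in [F]. *)
pose H (i : 'I_m.+1) := G (widen_ord mn i).
have HU i : UltraFilter (H i) by exact: GU.
have [|A [HA tA]] := ultra_separation HU.
  by move=> i j /Ginj /(congr1 val) /= /val_inj.
have [K [pK AK]] := trivIset_enlarge ord0 tA.
have [k /FG FK] := Fm K pK.
have /filter_ex[x [Ax]] : H k (A k `&` ~` K k) by apply: filterI; auto.
by apply; apply: AK.
Qed.

(** If [H] differed from every [G i], each [G i] would have a member [B i] whose complement is in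
    [H]. The union of the [B i] lies in all [G i], hence in [H], while by finiteness its complement
    is in [H] too. *)
Lemma ultra_bigcap_sub {I : Type} n (G : 'I_n -> set_system I)
    (H : set_system I) : (forall i, UltraFilter (G i)) -> UltraFilter H ->
  \bigcap_i G i `<=` H -> range G H.
Proof.
move=> GU HU GH; apply: contrapT => nGH.
have /choice[B BP] : forall i, exists B, G i B /\ H (~` B).
  move=> i; apply: contrapT => nB; apply: nGH; exists i => //.
  symmetry; apply: max_filter => B GB.
  by have [//|HB] := in_ultra_setVsetC B HU; case: nB; exists B.
have HC : H [set x | forall i, ~ B i x].
  by apply: filter_forall => i; have [] := BP i.
have HB : H (\bigcup_i B i).
  apply: GH => i _; have [GB _] := BP i; apply: filterS GB => x Bx; by exists i.
have /filter_ex[x [nB [i _ /nB]]] // :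
  H ([set x | forall i, ~ B i x] `&` \bigcup_i B i) by exact: filterI.
Qed.

Lemma decomposition_sub {I : Type} (F : set_system I)
    (U V : set (set_system I)) :
  finite_ultrafilter_decomposition F U ->
  finite_ultrafilter_decomposition F V -> V `<=` U.
Proof.
move=> [[n Un] Uultra FU] [_ Vultra FV] H VH.
have [G [_ UG]] := card_eq_II_range Un.
rewrite UG; apply: ultra_bigcap_sub; last 1 first.
- move=> A GA; suff : F A by rewrite FV; apply.
  by rewrite FU UG => _ [i _ <-]; apply: GA.
- by move=> i; apply: Uultra; rewrite UG; exists i.
- exact: Vultra.
Qed.

Lemma decomposition_least {I : Type} (F : set_system I) n
    (U : set (set_system I)) : finite_ultrafilter_decomposition F U ->
  U #= `I_n -> is_least (finite_partition_property F) n.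
Proof.
move=> [_ Uultra FU] /card_eq_II_range[G [Ginj UG]].
have GU i : UltraFilter (G i) by apply: Uultra; rewrite UG; exists i.
split.
  apply: (finite_of_decomposition GU) => A GA.
  by rewrite FU UG => _ [i _ <-]; apply: GA.
move=> m; apply: card_lower_bound GU Ginj _ => i A.
by rewrite FU; apply; rewrite UG; exists i.
Qed.

Theorem lemma3 (I : Type) (F : set_system I) (hF : Filter F) :
  [/\ infinite_partition_property F <-> omega_partition_property F,
      omega_partition_property F <->
        (exists n : nat, finite_partition_property F n)
    & (exists n : nat, finite_partition_property F n) <->
        (exists U : set (set_system I), finite_ultrafilter_decomposition F U)]
  /\
  ((exists U : set (set_system I), finite_ultrafilter_decomposition F U) ->
   (exists! U : set (set_system I), finite_ultrafilter_decomposition F U) /\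
   (forall U : set (set_system I), finite_ultrafilter_decomposition F U ->
     exists n : nat, U #= `I_n /\ is_least (finite_partition_property F) n)).
Proof.
have least U : finite_ultrafilter_decomposition F U ->
    exists n, U #= `I_n /\ is_least (finite_partition_property F) n.
  move=> dU; have [[n Un] _ _] := dU; exists n; split=> //.
  exact: decomposition_least dU Un.
(* The next three facts form the cycle (d) to (c) to (b) to (d). *)
have dc : decomposable F -> exists n, finite_partition_property F n.
  by move=> [U /least[n [_ []]]]; exists n.
have cb : (exists n, finite_partition_property F n) ->
    omega_partition_property F.
  by move=> [n]; apply: omega_of_finite.
have bd : omega_partition_property F -> decomposable F.
  exact: decomposable_of_omega.
split; last first.
  move=> [U dU]; split=> //; exists U; split=> // V dV.
  rewrite eqEsubset; split; first exact: decomposition_sub dV dU.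
  exact: decomposition_sub dU dV.
split; split.
- by move=> Fi J; apply: Fi; apply: infinite_nat.
- exact: infinite_of_omega.
- by move=> /bd/dc.
- exact: cb.
- by move=> /cb/bd.
- exact: dc.
Qed.
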